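(* Let $\mathcal{A}$ be a unital $C^*$-algebra, let $0\le\alpha\le1\le\beta$, and let $a\in \mathcal{A}$ be $(\alpha,\beta)$-normal. Then the following inequalities hold: $$v^2(a) \geq \frac14 \max \left\{ 1+\alpha^2, 1+\frac{1}{\beta^2}\right\}\|a\|^2 +\frac12 \Big| \|Re(a)\|^2-\|Im(a)\|^2 \Big| ,$$ $$v^2(a) \geq \frac14 \max \left\{ 1+\alpha^2, 1+\frac{1}{\beta^2}\right\}\|a\|^2 +\frac14 \Big| \|Re(a) +Im(a)\|^2-\|Re(a)-Im(a)\|^2 \Big| ,$$ $$v^2(a) \geq \frac14 \max \left\{ 1+\alpha^2, 1+\frac{1}{\beta^2}\right\}\|a\|^2 + \frac14(l+m),$$ where $l= \left| \|Re(a)\|^2-\frac14 \| a^*a+aa^*\| \right|$ and $m= \left| \|Im(a)\|^2-\frac14 \| a^*a+aa^*\| \right|$.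
   Context: $\mathcal{A}$ is a unital $C^*$-algebra with unit $e$. $S(\mathcal{A})$ is the set of normalized states, i.e. continuous linear functionals $f$ on $\mathcal{A}$ with $f(e)=\|f\|=1$. The algebraic numerical radius of $a$ is $v(a)=\sup\{|f(a)|: f\in S(\mathcal{A})\}$, and $v^2(a)$ means $(v(a))^2$. $Re(a)=\frac12(a+a^* )$ and $Im(a)=\frac{1}{2i}(a-a^* )$. A continuous linear functional $f$ on $\mathcal{A}$ is positive ($f\ge0$) if $f(x^*x)\ge 0$ for all $x\in\mathcal{A}$. For real numbers $0\leq \alpha\leq 1\leq \beta$, an element $a\in \mathcal{A}$ is $(\alpha,\beta)$-normal if $\alpha^2 f(a^*a)\leq f(aa^* )\leq \beta^2f(a^*a)$ for all positive continuous linear functionals $f$ on $\mathcal{A}$. *)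

(* Defs.v *)
From HB Require Import structures.
From mathcomp Require Import all_boot all_order all_algebra.
From mathcomp Require Import all_classical all_reals all_analysis.
From mathcomp Require Import complex.

Set Implicit Arguments.
Unset Strict Implicit.
Unset Printing Implicit Defensive.

Import Order.TTheory GRing.Theory Num.Theory.
Import numFieldNormedType.Exports.

Local Open Scope classical_set_scope.
Local Open Scope ring_scope.

Reserved Notation "x ** y" (at level 40, left associativity).

(* Unital C*-algebras. Complex Banach spaces are [completeNormedModType R[i]],
   whose norm takes values in R[i]. The product and the unit are fields of the
   mixin because the library has no common ancestor of its normed and ring
   structures below [numDomainType], which rules out a join with [algType].
   As usual for unital algebras the unit is nonzero; `|cone| = 1 follows from
   the C*-identity. *)
HB.mixin Record isCStarAlgebra (R : realType) A
    of CompleteNormedModule R[i] A := {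
  cone : A ;
  cmul : A -> A -> A ;
  star : A -> A ;
  cmulA : associative cmul ;
  cmul1l : left_id cone cmul ;
  cmul1r : right_id cone cmul ;
  cmulDl : left_distributive cmul +%R ;
  cmulDr : right_distributive cmul +%R ;
  cscaleAl : forall (k : R[i]) (x y : A), k *: cmul x y = cmul (k *: x) y ;
  cscaleAr : forall (k : R[i]) (x y : A), k *: cmul x y = cmul x (k *: y) ;
  cone_neq0 : cone != 0 ;
  cmul_norm_le : forall x y : A, `|cmul x y| <= `|x| * `|y| ;
  starD : forall x y : A, star (x + y) = star x + star y ;
  starZ : forall (k : R[i]) (x : A), star (k *: x) = (k^*)%C *: star x ;
  starM : forall x y : A, star (cmul x y) = cmul (star y) (star x) ;
  starK : involutive star ;
  cstar_identity : forall x : A, `|cmul (star x) x| = `|x| ^+ 2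
}.

#[short(type="cstarAlgType")]
HB.structure Definition CStarAlgebra (R : realType) :=
  {A of isCStarAlgebra R A & CompleteNormedModule R[i] A}.

Notation "x ** y" := (cmul x y) : ring_scope.

(* The norm as an element of R; `|x| is a nonnegative real number of R[i]. *)
Definition rnorm (R : realType) (V : normedModType R[i]) (x : V) : R :=
  complex.Re `|x|.

Section CStarAlgebra.
Variables (R : realType) (A : cstarAlgType R).

Definition rePart (a : A) : A := (2%:R : R[i])^-1 *: (a + star a).

Definition imPart (a : A) : A := (2%:R * 'i%C : R[i])^-1 *: (a - star a).

(* Since [sup] is 0 on unbounded sets, this is the norm of f only when f is
   continuous. *)
Definition functional_norm (f : {linear A -> R[i]^o}) : R :=
  sup [set rnorm (f x) | x in [set x : A | rnorm x <= 1]].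

Definition is_state (f : {linear A -> R[i]^o}) : Prop :=
  [/\ continuous f, f cone = 1 & functional_norm f = 1].

Definition numerical_radius (a : A) : R :=
  sup [set rnorm (f a) | f in [set f : {linear A -> R[i]^o} | is_state f]].

(* In R[i], x <= y means that y - x is real and nonnegative. *)
Definition is_positive (f : {linear A -> R[i]^o}) : Prop :=
  forall x : A, 0 <= f (star x ** x).

Definition alpha_beta_normal (alpha beta : R) (a : A) : Prop :=
  forall f : {linear A -> R[i]^o}, continuous f -> is_positive f ->
    ((alpha ^+ 2)%:C)%C * f (star a ** a) <= f (a ** star a) /\
    f (a ** star a) <= ((beta ^+ 2)%:C)%C * f (star a ** a).

End CStarAlgebra.

(* Main.v *)
(* Write p = Re a, q = Im a, S = a^* a + a a^* = 2 (p^2 + q^2) = (p + q)^2 + (p - q)^2.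
   A state f is real on selfadjoint elements, so |f(a)|^2 = f(p)^2 + f(q)^2; taking
   states that attain the norms of p, q, p + q and p - q gives
     v^2 >= ||p||^2, ||q||^2, ||p + q||^2 / 2, ||p - q||^2 / 2.
   A state attaining the norm of a^* a, or of a a^*, shows by (alpha, beta)-normality
   that ||S|| >= max(1 + alpha^2, 1 + 1 / beta^2) ||a||^2. As ||S|| is at most
   2 (||p||^2 + ||q||^2) and ||p + q||^2 + ||p - q||^2, the three inequalities
   follow by real arithmetic.

   Norm-attaining states come from the Hahn-Banach theorem. That they exist for
   every selfadjoint element and are positive on all x^* x is proved without spectral
   theory: h is called positive when ||t - h|| <= t for some t, square roots of
   strictly positive elements are fixed points of a contraction, and Kaplansky's
   argument that x^* x is positive only needs the norms of x^* x and x x^* to be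
   compared after a shift. *)

Require Import Defs.
From HB Require Import structures.
From mathcomp Require Import all_boot all_order all_algebra.
From mathcomp Require Import all_classical all_reals all_analysis.
From mathcomp Require Import complex ring lra.
Import Order.TTheory GRing.Theory Num.Theory.
Import numFieldNormedType.Exports.
Local Open Scope ring_scope.

Set Implicit Arguments.
Unset Strict Implicit.
Unset Printing Implicit Defensive.

(** * The C*-algebra as a normed algebra over the reals *)

(* An alias of A: real scalars and a real-valued norm make ssralg and the ordered-norm
   lemmas available, which the R[i]-valued norm of A does not. *)
Definition realAlg (R : realType) (A : cstarAlgType R) : Type := A.

Section RealAlg.
Variables (R : realType) (A : cstarAlgType R).
Local Notation B := (realAlg A).

HB.instance Definition _ := GRing.Zmodule.copy B A.

HB.instance Definition _ := GRing.Zmodule_isNzRing.Build B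
  (@cmulA R A) (@cmul1l R A) (@cmul1r R A) (@cmulDl R A) (@cmulDr R A)
  (@cone_neq0 R A).

Definition rscale (t : R) (x : B) : B := (t%:C)%C *: (x : A).

Lemma rscaleA s t x : rscale s (rscale t x) = rscale (s * t) x.
Proof. by rewrite /rscale scalerA rmorphM. Qed.

Lemma rscale1 : left_id 1 rscale.
Proof. by move=> x; rewrite /rscale rmorph1 scale1r. Qed.

Lemma rscaleDr : right_distributive rscale +%R.
Proof. by move=> t x y; rewrite /rscale scalerDr. Qed.

Lemma rscaleDl x : {morph rscale^~ x : s t / s + t}.
Proof. by move=> s t; rewrite /rscale rmorphD scalerDl. Qed.

HB.instance Definition _ :=
  GRing.Zmodule_isLmodule.Build R B rscaleA rscale1 rscaleDr rscaleDl.

Lemma rscaleAl (t : R) (x y : B) : t *: (x * y) = t *: x * y.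
Proof. exact: cscaleAl. Qed.

HB.instance Definition _ := GRing.Lmodule_isLalgebra.Build R B rscaleAl.

Lemma rscaleAr (t : R) (x y : B) : t *: (x * y) = x * (t *: y).
Proof. exact: cscaleAr. Qed.

HB.instance Definition _ := GRing.Lalgebra_isAlgebra.Build R B rscaleAr.

Lemma rnormC (V : normedModType R[i]) (x : V) : `|x| = ((rnorm x)%:C)%C.
Proof. by rewrite /rnorm RRe_real// normr_real. Qed.

Lemma rnorm_ge0 (V : normedModType R[i]) (x : V) : 0 <= rnorm x.
Proof. by have := normr_ge0 x; rewrite rnormC lecR. Qed.

Lemma rnormD (V : normedModType R[i]) (x y : V) : rnorm (x + y) <= rnorm x + rnorm y.
Proof. by rewrite -lecR rmorphD/= -!rnormC ler_normD. Qed.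

Lemma rnorm0_eq0 (V : normedModType R[i]) (x : V) : rnorm x = 0 -> x = 0.
Proof. by move=> x0; apply/normr0_eq0; rewrite rnormC x0. Qed.

Lemma rnormMn (V : normedModType R[i]) (x : V) n : rnorm (x *+ n) = rnorm x *+ n.
Proof. by apply/complexI; rewrite rmorphMn/= -!rnormC normrMn. Qed.

Lemma rnormN (V : normedModType R[i]) (x : V) : rnorm (- x) = rnorm x.
Proof. by rewrite /rnorm normrN. Qed.

HB.instance Definition _ := Num.Zmodule_isNormed.Build R B
  (@rnormD A) (@rnorm0_eq0 A) (@rnormMn A) (@rnormN A).

Lemma rnormZ (V : normedModType R[i]) (k : R[i]) (x : V) :
  rnorm (k *: x) = complex.Re `|k| * rnorm x.
Proof.
by apply/complexI; rewrite rmorphM/= -!rnormC normrZ; congr (_ * _).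
Qed.

Implicit Types (x y h : B) (s t : R).

Lemma normZ t x : `|t *: x| = `|t| * `|x|.
Proof.
rewrite -[LHS]/(rnorm (t%:C%C *: (x : A))) rnormZ; congr (_ * _).
by rewrite normc_def/= expr0n addr0 sqrtr_sqr.
Qed.

Lemma normM x y : `|x * y| <= `|x| * `|y|.
Proof.
change (rnorm ((x : A) ** (y : A)) <= rnorm (x : A) * rnorm (y : A)).
by rewrite -lecR rmorphM/= -!rnormC cmul_norm_le.
Qed.

Definition adj (x : B) : B := star (x : A).

Lemma adjK : involutive adj. Proof. exact: starK. Qed.
Lemma adjD x y : adj (x + y) = adj x + adj y. Proof. exact: starD. Qed.
Lemma adjM x y : adj (x * y) = adj y * adj x. Proof. exact: starM. Qed.
Lemma adjZ t x : adj (t *: x) = t *: adj x.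
Proof. by rewrite /adj starZ conjc_real. Qed.
Lemma adjN x : adj (- x) = - adj x.
Proof. by rewrite -scaleN1r adjZ scaleN1r. Qed.
Lemma adjB x y : adj (x - y) = adj x - adj y.
Proof. by rewrite adjD adjN. Qed.
Lemma adj1 : adj 1 = 1.
Proof. by rewrite -[LHS]mulr1 -[X in _ * X](adjK 1) -adjM mulr1 adjK. Qed.
Lemma adj0 : adj 0 = 0.
Proof. by rewrite -(scale0r (1 : B)) adjZ !scale0r. Qed.
Lemma adjX x n : adj (x ^+ n) = adj x ^+ n.
Proof. by elim: n => [|n ih]; rewrite ?adj1// exprS adjM ih exprSr. Qed.

Lemma cstar x : `|adj x * x| = `|x| ^+ 2.
Proof.
apply/complexI; rewrite rmorphXn/=.
by have := cstar_identity (x : A); rewrite !rnormC => ->.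
Qed.

(** Cancel |y| in |y|^2 = |y^* y| <= |y^*| |y|, then apply the result to the adjoint. *)
Lemma norm_adj x : `|adj x| = `|x|.
Proof.
suff le_adj y : `|y| <= `|adj y|
  by apply/le_anti/andP; split=> //; have := le_adj (adj x); rewrite adjK.
have [->|y0] := eqVneq y 0; first by rewrite normr0.
have y_gt0 : 0 < `|y| by rewrite normr_gt0.
by rewrite -(ler_pM2r y_gt0) -expr2 -cstar normM.
Qed.

Lemma norm1 : `|1 : B| = 1.
Proof.
have := cstar 1; rewrite adj1 mulr1 expr2 -[LHS]mulr1 => /mulfI -> //.
by rewrite normr_eq0 oner_neq0.
Qed.

Lemma normA t : `|t%:A : B| = `|t|. Proof. by rewrite normZ norm1 mulr1. Qed.

Lemma adjA t : adj t%:A = t%:A. Proof. by rewrite adjZ adj1. Qed.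

Lemma norm_sqr h : adj h = h -> `|h * h| = `|h| ^+ 2.
Proof. by move=> hh; rewrite -cstar hh. Qed.

(** Stands in for the spectral radius formula: it recovers |h| as the growth rate of the powers of
    h. *)
Lemma norm_exp2 h k : adj h = h -> `|h ^+ (2 ^ k)| = `|h| ^+ (2 ^ k).
Proof.
move=> hh; elim: k => [|k ih]; first by rewrite !expr1.
by rewrite expnS mulnC !exprM expr2 norm_sqr ?ih// adjX hh.
Qed.

Lemma normX x n : `|x ^+ n| <= `|x| ^+ n.
Proof.
elim: n => [|n ih]; first by rewrite !expr0 norm1.
by rewrite !exprS (le_trans (normM _ _))// ler_wpM2l.
Qed.

(** The scalar i as a central element, since [realAlg] has real scalars only. *)
Definition imag : B := 'i%C *: (cone : A).

Lemma imagC x : x * imag = imag * x.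
Proof.
have : x ** imag = 'i%C *: (x : A) by rewrite /imag -cscaleAr cmul1r.
have : imag ** x = 'i%C *: (x : A) by rewrite /imag -cscaleAl cmul1l.
by move=> e1 e2; exact: (etrans e2 (esym e1)).
Qed.

Lemma imag_sqr : imag * imag = -1.
Proof.
change ((imag : A) ** (imag : A) = - (cone : A)).
by rewrite /imag -cscaleAl -cscaleAr scalerA cmul1l -expr2 sqr_i scaleN1r.
Qed.

Lemma adj_imag : adj imag = - imag.
Proof.
rewrite /adj /imag starZ -[star cone]/(adj 1) adj1.
have -> : ('i^*)%C = - 'i%C :> R[i] by apply/eqP; rewrite eq_complex/= oppr0 !eqxx.
by rewrite scaleNr.
Qed.

End RealAlg.

(** * Square roots and the positive cone *)

Lemma geometric_small (R : realType) (C q e : R) : 0 <= q < 1 -> 0 < e ->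
  exists N, forall n, (N <= n)%N -> C * q ^+ n < e.
Proof.
move=> /andP[q0 q1] e0; have q1' : `|q| < 1 by rewrite ger0_norm.
have /cvgrPdist_lt/(_ _ e0)[N _ NP] := cvg_geometric C q1'.
exists N => n Nn; have := NP n Nn; rewrite /= sub0r normrN.
exact/le_lt_trans/ler_norm.
Qed.

Lemma geometric_le0 (R : realType) (C q d : R) : 0 <= q < 1 ->
  (forall n, d <= C * q ^+ n) -> d <= 0.
Proof.
move=> q01 dle; rewrite leNgt; apply/negP => d0.
have [N /(_ N (leqnn N))] := geometric_small C q01 d0.
by rewrite ltNge dle.
Qed.

Section SquareRoot.
Variables (R : realType) (A : cstarAlgType R).
Local Notation B := (realAlg A).
Implicit Types (x y h b c : B) (s t : R).

(** Completeness is that of A, so [u] is reread there as [v], with [rnormC] relating the two norms;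
    the rate then passes to the limit. *)
Lemma geometric_cvg (u : nat -> B) (C q : R) : 0 <= q < 1 ->
  (forall n m, (n <= m)%N -> `|u n - u m| <= C * q ^+ n) ->
  exists l, forall n, `|u n - l| <= C * q ^+ n.
Proof.
move=> q01 ucau; pose v : nat -> A := u.
have vdist n m (e : R[i]) : 0 < e -> `|u n - u m| < complex.Re e -> `|v n - v m| < e.
  move=> e0; have eE : e = ((complex.Re e)%:C)%C by rewrite RRe_real// gtr0_real.
  by rewrite {2}eE rnormC ltcR.
have : cvgn v.
  apply/cauchy_cvgP/cauchy_exP => e e0.
  have Re0 : 0 < complex.Re e by move: e0; rewrite ltcE => /andP[].
  have [N NP] := geometric_small C q01 Re0.
  exists (v N); exists N => // n /= Nn; rewrite -ball_normE /=; apply: vdist => //.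
  by rewrite (le_lt_trans (ucau _ _ Nn))// NP.
move=> /cvg_ex[l vl]; exists (l : B) => n.
apply/ler_addgt0Pr => e e0; have e0' : (0 : R[i]) < (e%:C)%C by rewrite ltcR.
have /cvgrPdist_lt/(_ _ e0')[N _ NP] := vl.
have {NP} := NP (maxn n N) (leq_maxr n N).
rewrite /= rnormC ltcR => lv.
have := ler_distD (u (maxn n N)) (u n) (l : B) => /le_trans; apply.
rewrite lerD ?ucau ?leq_maxl// distrC; exact: ltW.
Qed.

(* The square root is [1 - l] for the fixed point [l] of [x |-> (k + x^2) / 2], a
   contraction of the ball of radius [`|k|]. *)
Lemma sqrt_one_sub (k : B) : adj k = k -> `|k| < 1 ->
  exists b : B, [/\ adj b = b, b * b = 1 - k, `|1 - b| <= `|k|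
    & forall c, c * k = k * c -> c * b = b * c].
Proof.
move=> kk; set r := `|k| => r1; have r0 : 0 <= r by rewrite normr_ge0.
have r01 : 0 <= r < 1 by rewrite r0.
pose f (x : B) := 2^-1 *: (k + x * x); pose u n := iter n f 0.
have half0 : `|2^-1 : R| = 2^-1 by rewrite ger0_norm// invr_ge0.
have fball x : `|x| <= r -> `|f x| <= r.
  move=> xr; rewrite normZ half0 ler_pdivrMl//.
  have -> : 2 * r = r + r by ring.
  rewrite (le_trans (ler_normD _ _))// lerD2l (le_trans (normM _ _))//.
  rewrite (le_trans (ler_pM _ _ xr xr))//.
  by rewrite ler_piMl// ltW.
have ub n : `|u n| <= r by elim: n => [|n /fball//]; rewrite normr0.
have fdist x y : `|x| <= r -> `|y| <= r -> `|f x - f y| <= r * `|x - y|.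
  move=> xr yr; rewrite -scalerBr normZ half0 ler_pdivrMl//.
  have -> : k + x * x - (k + y * y) = x * (x - y) + (x - y) * y.
    by rewrite mulrBr mulrBl opprD addrACA subrr add0r addrA subrK.
  rewrite (le_trans (ler_normD _ _))//.
  have -> : 2 * (r * `|x - y|) = r * `|x - y| + `|x - y| * r by ring.
  by rewrite lerD// (le_trans (normM _ _))// ler_pM.
have [l ul] : exists l, forall n, `|u n - l| <= 2 * r ^+ n.
  (* The contraction reduces this to n = 0, where two points of the ball of radius r < 1 are at
     distance at most 2. *)
  apply: geometric_cvg => // n m /subnKC <-; move: (m - n)%N => d {m}.
  elim: n => [|n ih].
    rewrite expr0 mulr1 (le_trans (ler_normB _ _))//.
    by rewrite [X in _ <= X](_ : 2 = 1 + 1)// lerD// (le_trans (ub _))// ltW.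
  rewrite addSn /= (le_trans (fdist _ _ (ub _) (ub _)))//.
  by rewrite exprS mulrCA ler_wpM2l.
have lr : `|l| <= r.
  rewrite -subr_le0; apply: (@geometric_le0 _ 2 r) => // n.
  rewrite lerBlDl; rewrite -[l](subrKC (u n)) (le_trans (ler_normD _ _))//.
  by rewrite lerD// distrC.
have eq_of x y C : (forall n, `|x - y| <= C * r ^+ n) -> x = y.
  move=> /(geometric_le0 r01); rewrite normr_le0 subr_eq0 => /eqP//.
have lfix : f l = l.
  apply: (eq_of _ _ (2 * r + 2 * r)) => n.
  rewrite (le_trans (ler_distD (f (u n)) _ _))// mulrDl lerD//.
    rewrite (le_trans (fdist _ _ _ (ub _)))// (_ : 2 * r * _ = r * (2 * r ^+ n)).
      by rewrite ler_wpM2l// distrC.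
    by ring.
  by have := ul n.+1; rewrite exprS mulrA.
have uadj n : adj (u n) = u n.
  by elim: n => [|n ih]; rewrite ?adj0// [u _]/= /f adjZ adjD adjM ih kk.
have ladj : adj l = l.
  apply: (eq_of _ _ (2 + 2)) => n.
  rewrite (le_trans (ler_distD (u n) _ _))// mulrDl lerD//.
  by rewrite -{1}(uadj n) -adjB norm_adj distrC.
exists (1 - l); split.
- by rewrite adjB adj1 ladj.
(* The fixed point equation reads 2 l = k + l^2, so (1 - l)^2 = 1 - k. *)
- have -> : k = l + l - l * l.
    apply/esym/eqP; rewrite subr_eq -mulr2n -scaler_nat -{1}lfix /f scalerA.
    by rewrite mulfV ?pnatr_eq0// scale1r.
  by rewrite mulrBl mul1r mulrBr mulr1 -addrA -opprD addrA.
- by rewrite subKr.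
move=> c ck.
(* The iterates are polynomials in k, so they commute with c; the limit inherits this. *)
have cu n : c * u n = u n * c.
  elim: n => [|n ih]; rewrite ?mulr0 ?mul0r//= /f -scalerAl -scalerAr.
  by rewrite mulrDr mulrDl ck mulrA ih -mulrA ih mulrA.
rewrite mulrBr mulrBl mulr1 mul1r; congr (_ - _).
apply: (eq_of _ _ (`|c| * 2 + 2 * `|c|)) => n.
have -> : c * l - l * c = c * (l - u n) + (u n - l) * c.
  by rewrite mulrBr mulrBl cu addrA subrK.
rewrite (le_trans (ler_normD _ _))// [leRHS]mulrDl lerD// (le_trans (normM _ _))//.
  by rewrite -mulrA ler_wpM2l// distrC.
by rewrite mulrAC ler_wpM2r.
Qed.
End SquareRoot.

Section PositiveCone.
Variables (R : realType) (A : cstarAlgType R).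
Local Notation B := (realAlg A).
Implicit Types (x y h b c : B) (s t : R).

Lemma imagMM x y : imag A * x * (imag A * y) = - (x * y).
Proof. by rewrite mulrA -(mulrA _ x) imagC mulrA imag_sqr mulN1r mulNr. Qed.

(* For selfadjoint h, [`|t - h| <= t] puts the spectrum of h in [0, 2t]; with t
   existentially quantified, closure under sums is the triangle inequality. *)
Definition pos (h : B) := adj h = h /\ exists t : R, `|t%:A - h| <= t.

Lemma commZ c h t : GRing.comm c h -> GRing.comm c (t *: h).
Proof. by move=> ch; rewrite /GRing.comm -scalerAr -scalerAl ch. Qed.

Lemma commA c t : GRing.comm c t%:A.
Proof. by apply: commZ; exact: commr1. Qed.

Lemma posD x y : pos x -> pos y -> pos (x + y).
Proof.
move=> [xx [s sx]] [yy [t ty]]; split; first by rewrite adjD xx yy.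
exists (s + t); rewrite scalerDl opprD addrACA (le_trans (ler_normD _ _))//.
exact: lerD.
Qed.

Lemma posZ t x : 0 <= t -> pos x -> pos (t *: x).
Proof.
move=> t0 [xx [s sx]]; split; first by rewrite adjZ xx.
by exists (t * s); rewrite -scalerA -scalerBr normZ ger0_norm// ler_wpM2l.
Qed.

Lemma normr_pos_sub h t : adj h = h -> `|h| <= t -> pos (t%:A - h).
Proof. by move=> hh ht; split; [rewrite adjB adjA hh|exists t; rewrite subKr]. Qed.

Lemma posA t : 0 <= t -> pos t%:A.
Proof.
move=> t0; have := @normr_pos_sub 0 t; rewrite subr0 normr0; apply => //.
exact: adj0.
Qed.

Lemma posA_ge0 t : pos t%:A -> 0 <= t.
Proof.
move=> [_ [s]]; rewrite -scalerBl normA => st.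
by have := le_trans (ler_norm _) st; lra.
Qed.

Lemma pos_sqrt h t : pos h -> 0 < t -> exists b : B,
  [/\ pos b, b * b = h + t%:A & forall c, GRing.comm c h -> GRing.comm c b].
Proof.
move=> [hh [r rh]] t0; have r0 : 0 <= r := le_trans (normr_ge0 _) rh.
have s0 : 0 < r + t by lra.
(* h + t = (r + t)(1 - k), and |r - h| <= r gives |k| <= r / (r + t) < 1. *)
pose k := (r + t)^-1 *: (r%:A - h).
have kk : adj k = k by rewrite adjZ adjB adjA hh.
have k1 : `|k| < 1.
  by rewrite normZ gtr0_norm ?invr_gt0// mulrC ltr_pdivrMr// mul1r; lra.
have [b [bb bsq b1 bc]] := sqrt_one_sub kk k1.
exists (Num.sqrt (r + t) *: b); split.
- apply: posZ; first exact: sqrtr_ge0.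
  split=> //; exists 1; rewrite scale1r (le_trans b1)//; exact: ltW.
- rewrite -scalerAl -scalerAr scalerA -expr2 sqr_sqrtr; last exact: ltW.
  rewrite bsq /k scalerBr scalerA mulfV ?gt_eqF// scale1r scalerDl opprB addrC.
  by rewrite addrA subrK.
move=> c ch; apply/commZ/bc; apply: commZ; apply: commrB => //; exact: commA.
Qed.

Lemma adj_cartesian h d : adj h = h -> adj d = d ->
  adj (h + imag A * d) = h - imag A * d.
Proof. by move=> hh dd; rewrite adjD adjM hh dd adj_imag mulrN imagC. Qed.

Lemma adj_mul_cartesian h d : adj h = h -> adj d = d -> GRing.comm h d ->
  adj (h + imag A * d) * (h + imag A * d) = h * h + d * d.
Proof.
move=> hh dd hd; rewrite adj_cartesian//.
have hz : h * (imag A * d) = imag A * d * h.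
  by rewrite mulrA imagC -!mulrA hd.
by rewrite mulrBl !mulrDr hz opprD addrA addrK imagMM opprK.
Qed.

(* [h + i d] is [s] times a unitary. *)
Lemma norm_of_sum_sqr h d s : adj h = h -> adj d = d -> GRing.comm h d ->
  0 <= s -> h * h + d * d = (s ^+ 2)%:A -> `|h| <= s.
Proof.
move=> hh dd hd s0 E; pose u := h + imag A * d.
have us : `|u| = s.
  apply/eqP; rewrite -(eqrXn2 (n := 2))// -cstar adj_mul_cartesian// E normA.
  by rewrite ger0_norm// exprn_ge0.
have uE : adj u = h - imag A * d by exact: adj_cartesian.
have -> : h = 2^-1 *: (u + adj u).
  by rewrite uE /u addrACA subrr addr0 -mulr2n -(scaler_nat 2 h) scalerA mulVf
    ?scale1r.
rewrite normZ gtr0_norm ?invr_gt0// ler_pdivrMl// (le_trans (ler_normD _ _))//.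
by rewrite norm_adj us; lra.
Qed.

(** With commuting square roots b, c of t + e - h and t + e + h, one has h^2 + (b c)^2 = (t + e)^2,
    and [norm_of_sum_sqr] gives |h| <= t + e for every e > 0. *)
Lemma pos_norm h t : pos (t%:A - h) -> pos (t%:A + h) -> `|h| <= t.
Proof.
move=> ph1 ph2; have t0 : 0 <= t.
  have := posD ph1 ph2; rewrite addrCA subrK -scalerDl => /posA_ge0; lra.
have hh : adj h = h by case: ph2; rewrite adjD adjA => /addrI.
apply/ler_addgt0Pr => e e0.
have [b [[bb _] bsq bC]] := pos_sqrt ph1 e0.
have [c [[cc _] csq cC]] := pos_sqrt ph2 e0.
have hb : GRing.comm h b by apply: bC; apply: commrB => //; exact: commA.
have hc : GRing.comm h c by apply: cC; apply: commrD => //; exact: commA.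
have bc : GRing.comm b c.
  apply: cC; apply: commrD; first exact: commA.
  exact: commr_sym.
apply: (@norm_of_sum_sqr _ (b * c)) => //.
- by rewrite adjM bb cc.
- exact: commrM.
- by rewrite addr_ge0// ltW.
have -> : b * c * (b * c) = (b * b) * (c * c).
  by rewrite -!mulrA; congr (_ * _); rewrite mulrA -bc mulrA.
rewrite bsq csq.
have -> : t%:A - h + e%:A = (t + e)%:A - h :> B by rewrite addrAC -scalerDl.
have -> : t%:A + h + e%:A = (t + e)%:A + h :> B by rewrite addrAC -scalerDl.
rewrite mulrDr !mulrBl (commA h) subrKA addrC subrK.
by rewrite -scalerAl mul1r scalerA -expr2.
Qed.

(** Any bound of |h| can thus serve as the witness in [pos]: both t - (t - h) = h and t + (t - h)
    are positive. *)
Lemma pos_subP h t : pos h -> `|h| <= t -> `|t%:A - h| <= t.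
Proof.
move=> ph ht; apply: pos_norm; first by rewrite subKr.
apply: posD; first by apply/posA/(le_trans _ ht).
by apply: normr_pos_sub; case: ph.
Qed.

Lemma pos_closed h : (forall e, 0 < e -> pos (h + e%:A)) -> pos h.
Proof.
move=> ph; split.
  by have [] := ph _ ltr01; rewrite adjD adjA => /addIr.
(* A witness independent of e: for e <= 1 it bounds |h + e|, so [pos_subP] applies to h + e, and e
   can tend to 0. *)
exists (`|h| + 1); apply/ler_addgt0Pr => e e0.
wlog e1 : e e0 / e <= 1.
  move=> H; have [/H->//|/ltW e1] := leP e 1.
  by rewrite (le_trans (H _ ltr01 (lexx _)))// lerD2l.
rewrite (_ : _ - h = (`|h| + 1)%:A - (h + e%:A) + e%:A); last first.
  by rewrite opprD addrA subrK.
rewrite (le_trans (ler_normD _ _))// lerD//; last by rewrite normA gtr0_norm.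
apply: pos_subP; first exact: ph.
by rewrite (le_trans (ler_normD _ _))// normA gtr0_norm// lerD2l.
Qed.

(** Scale h to k with |k| < 1 and take b with b^2 = 1 - k^2. Then b^2 + k^2 = 1 gives |b| <= 1, so
    |1 - k^2| <= 1. *)
Lemma pos_sqr h : adj h = h -> pos (h * h).
Proof.
move=> hh; set s := `|h| + 1.
have s0 : 0 < s by rewrite ltr_wpDl.
have ks : adj (s^-1 *: h) = s^-1 *: h by rewrite adjZ hh.
set k := s^-1 *: h in ks.
have k1 : `|k| < 1.
  by rewrite normZ gtr0_norm ?invr_gt0// mulrC ltr_pdivrMr// mul1r ltrDl.
have kk : adj (k * k) = k * k by rewrite adjM ks.
have kk1 : `|k * k| < 1 by rewrite norm_sqr// expr_lt1.
have [b [bb bsq _ bC]] := sqrt_one_sub kk kk1.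
have b1 : `|b| <= 1.
  apply: (@norm_of_sum_sqr _ k) => //.
    by apply/commr_sym/bC; rewrite mulrA.
  by rewrite bsq subrK expr1n scale1r.
have -> : h * h = s ^+ 2 *: (k * k).
  rewrite /k -scalerAl -scalerAr !scalerA -mulrA -invfM -expr2 mulfV ?scale1r//.
  by rewrite expf_neq0// gt_eqF.
apply: posZ; first exact: sqr_ge0.
by split => //; exists 1; rewrite scale1r -bsq norm_sqr// expr_le1.
Qed.

(** If r^2 = b + d commutes suitably with w, then w b w = (w r)^2 - d w^2, and d is chosen so small
    that e absorbs d w^2. *)
Lemma pos_conj b w : pos b -> adj w = w -> GRing.comm w b -> pos (w * b * w).
Proof.
move=> pb ww wb; apply: pos_closed => e e0.
pose d := e / (`|w * w| + 1).
have n0 : 0 < `|w * w| + 1 by rewrite ltr_wpDl.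
have d0 : 0 < d by rewrite divr_gt0.
have [r [[rr _] rsq rC]] := pos_sqrt pb d0.
have wr := rC _ wb.
have -> : w * b * w + e%:A =
    (w * r) * (w * r) + d *: ((`|w * w| + 1)%:A - w * w).
  have -> : w * r * (w * r) = w * (r * r) * w by rewrite -!mulrA (wr : w * r = _).
  rewrite rsq mulrDr mulrDl -scalerAr mulr1 -scalerAl scalerBr scalerA divfK ?gt_eqF//.
  by rewrite addrACA subrr addr0.
apply: posD.
  by apply: pos_sqr; rewrite adjM ww rr.
apply: posZ; first exact: ltW.
apply: normr_pos_sub; first by rewrite adjM ww.
by rewrite lerDl.
Qed.

(* With [v = s - x^* x] and [w = s - x x^*], [v ^ n.+1 = s v ^ n - x^* w ^ n x],
   and [`|v ^ n| = `|v| ^ n] for n a power of 2: as for spectra, the growth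
   rates of the powers of v and w agree up to s. *)
Lemma norm_sub_swap x s M : 0 <= s -> s <= M -> `|s%:A - x * adj x| <= M ->
  `|s%:A - adj x * x| <= M.
Proof.
move=> s0 sM; set w := s%:A - x * adj x => wM; set v := s%:A - adj x * x.
rewrite leNgt; apply/negP => Mv.
have vv : adj v = v by rewrite adjB adjA adjM adjK.
have M0 : 0 <= M by apply: le_trans sM.
have v0 : 0 < `|v| by apply: le_lt_trans Mv.
have xv n : x * v ^+ n = w ^+ n * x.
  elim: n => [|n ih]; first by rewrite !expr0 mulr1 mul1r.
  rewrite exprSr mulrA ih exprSr -!mulrA; congr (_ * _).
  by rewrite mulrBr mulrBl commA mulrA.
have vn n : `|v ^+ n.+1| <= s * `|v| ^+ n + `|x| ^+ 2 * M ^+ n.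
  rewrite exprS {1}/v mulrBl -scalerAl mul1r -mulrA xv.
  rewrite (le_trans (ler_normB _ _))// lerD//.
    by rewrite normZ ger0_norm// ler_wpM2l// normX.
  rewrite (le_trans (normM _ _))// norm_adj expr2 -mulrA ler_wpM2l//.
  rewrite (le_trans (normM _ _))// mulrC ler_wpM2l// (le_trans (normX _ _))//.
  by rewrite lerXn2r ?nnegrE.
(* If |v| > M, then |v| - s is at most |x|^2 times powers of M / |v|, which tend to 0; so |v| <= s
   <= M. *)
suff : `|v| - s <= 0 by rewrite subr_le0 leNgt (le_lt_trans sM Mv).
have q01 : 0 <= M / `|v| < 1 by rewrite divr_ge0//= ltr_pdivrMr// mul1r.
apply: (@geometric_le0 _ (`|x| ^+ 2) _ _ q01) => n.
(* The recurrence is used at exponent 2^n - 1, so that its left side is |v|^(2^n) by [norm_exp2]. *)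
have n2 : (n <= (2 ^ n).-1)%N by rewrite -ltnS prednK ?expn_gt0// ltn_expl.
have := vn (2 ^ n).-1; rewrite prednK ?expn_gt0// norm_exp2//.
rewrite -[X in `|v| ^+ X](@prednK (2 ^ n)) ?expn_gt0// exprS -lerBlDl -mulrBl.
move=> H; have {H} : `|v| - s <= `|x| ^+ 2 * (M / `|v|) ^+ (2 ^ n).-1.
  by rewrite expr_div_n mulrA ler_pdivlMr// exprn_gt0.
move=> /le_trans; apply; rewrite ler_wpM2l ?exprn_ge0//.
case/andP: q01 => q0 q1.
by rewrite ler_wiXn2l// ltW.
Qed.

(** * Real and imaginary parts *)

Lemma rePartE x : rePart x = 2^-1 *: (x + adj x) :> B.
Proof.
rewrite /rePart; have -> : (2%:R^-1 : R[i]) = ((2^-1 : R)%:C)%C.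
  by rewrite fmorphV rmorph_nat.
by [].
Qed.

Lemma imPartE x : imPart x = 2^-1 *: (imag A * (adj x - x)) :> B.
Proof.
have -> : imag A * (adj x - x) = 'i%C *: (adj x - x : A).
  by rewrite -[LHS]/(('i%C *: (cone : A)) ** (adj x - x : A)) -cscaleAl cmul1l.
rewrite -[RHS]/(((2^-1 : R)%:C)%C *: ('i%C *: (adj x - x : A))) /imPart.
have i0 : 'i%C != 0 :> R[i] by rewrite eq_complex/= oner_eq0 andbF.
have kE : - (2 * 'i%C)^-1 = ((2^-1 : R)%:C)%C * 'i%C :> R[i].
  rewrite fmorphV rmorph_nat; apply: (mulIf i0).
  by rewrite -mulrA -expr2 sqr_i mulrN1 mulNr invfM divfK.
by rewrite -[x - _ in LHS]opprB scalerN -scaleNr scalerA kE.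
Qed.

Lemma rePart_adj x : adj (rePart x) = rePart x :> B.
Proof. by rewrite rePartE adjZ adjD adjK addrC. Qed.

Lemma imPart_adj x : adj (imPart x) = imPart x :> B.
Proof.
by rewrite imPartE adjZ adjM adjB adjK adj_imag mulrN imagC -mulrN opprB.
Qed.

Lemma cartesianE x : x = (rePart x : B) + imag A * imPart x.
Proof.
rewrite rePartE imPartE -scalerAr mulrA imag_sqr mulN1r opprB -scalerDr.
by rewrite addrACA subrr addr0 -mulr2n -(scaler_nat 2 x) scalerA mulVf ?scale1r.
Qed.

Lemma adj_self_add x : adj x * x + x * adj x =
  2 *: ((rePart x : B) * rePart x + (imPart x : B) * imPart x).
Proof.
have xx : adj x = (rePart x : B) - imag A * imPart x.
  by rewrite {1}(cartesianE x) adj_cartesian ?rePart_adj ?imPart_adj.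
have : x = (rePart x : B) + imag A * imPart x := cartesianE x.
rewrite xx; move: (rePart x : B) (imPart x : B) => p q ->.
(* With z = i q one has x = p + z and x^* = p - z; the mixed terms cancel and z^2 = - q^2. *)
have -> : p * p + q * q = p * p - (imag A * q) * (imag A * q) by rewrite imagMM opprK.
move: (imag A * q) => z.
rewrite mulrBl mulrBr !mulrDl !mulrDr addrACA -opprD.
rewrite [p * p + p * z + _]addrACA [z * p + z * z + _]addrACA.
rewrite [z * p + p * z]addrC addrKA.
by rewrite (scaler_nat 2) mulr2n addrACA -opprD.
Qed.

Lemma self_add_pos x : pos (adj x * x + x * adj x).
Proof.
rewrite adj_self_add; apply: posZ => //.
by apply: posD; apply: pos_sqr; rewrite ?rePart_adj ?imPart_adj.
Qed.

End PositiveCone.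

(** * Positivity of x^* x *)

Section Kaplansky.
Variables (R : realType) (A : cstarAlgType R).
Local Notation B := (realAlg A).
Implicit Types (x y h b c : B) (s t : R).

Lemma adj_mul_self x : adj (adj x * x) = adj x * x.
Proof. by rewrite adjM adjK. Qed.

(* x^* x <= t and x^* x + x x^* >= 0 give x x^* >= - t, which [norm_sub_swap]
   turns into x^* x >= - t. *)
Lemma norm_le_of_pos_sub x t : 0 <= t -> pos (t%:A - adj x * x) ->
  `|adj x * x| <= t.
Proof.
move=> t0 pt.
have pxx : pos (x * adj x + t%:A).
  rewrite -[x * _](addKr (adj x * x)) addrAC [- _ + _]addrC.
  by apply: posD => //; exact: self_add_pos.
have ux : `|(`|x| ^+ 2)%:A - x * adj x| <= `|x| ^+ 2 + t.
  have := @pos_subP _ _ _ (`|x| ^+ 2 + t) pxx.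
  rewrite scalerDl opprD addrACA subrr addr0.
  apply; rewrite (le_trans (ler_normD _ _))// normA ger0_norm// lerD2r.
  by rewrite -(norm_adj x) -cstar adjK.
have xu : pos (t%:A + adj x * x).
  split; first by rewrite adjD adjA adj_mul_self.
  exists (`|x| ^+ 2 + t); rewrite scalerDl [t%:A + _]addrC opprD addrACA subrr addr0.
  by apply: norm_sub_swap ux; [exact: exprn_ge0|rewrite lerDl].
exact: pos_norm.
Qed.

(* Kaplansky's argument for c = x^* x. Here w = b - c with b = (c^2 + d)^(1/2)
   approximates |c| - c, twice the negative part of c, so that y = x w has
   y^* y = w c w = d w - w b w <= d w; by [norm_le_of_pos_sub], w c w is small,
   hence so is w^3 = d w - 2 w c w, and c = b - w is positive up to a small error. *)
Lemma adj_mul_self_pos x : pos (adj x * x).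
Proof.
set c := adj x * x; have cc : adj c = c := adj_mul_self x.
apply: pos_closed => e e0.
(* K bounds |w|, since |b|^2 = |c^2 + d| <= (|c| + 1)^2 when d <= 1; then d is taken so that |w^3|
   <= 3 d K <= e^3. *)
pose K := `|c| + `|c| + 1.
have K0 : 0 < K by rewrite ltr_wpDl// addr_ge0.
pose d := Num.min 1 (e ^+ 3 / (3 * K)).
have d0 : 0 < d by rewrite lt_min ltr01 divr_gt0 ?exprn_gt0 ?mulr_gt0.
have d1 : d <= 1 by rewrite ge_min lexx.
have dK : 3 * d * K <= e ^+ 3.
  have : d <= e ^+ 3 / (3 * K) by rewrite ge_min lexx orbT.
  by rewrite ler_pdivlMr ?mulr_gt0//; apply: le_trans; rewrite mulrCA mulrA.
have [b [pb bsq bC]] := pos_sqrt (pos_sqr cc) d0.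
have cb : GRing.comm c b by apply: bC; apply: commrM.
have bb : adj b = b by case: pb.
have [w wE] : exists w, w = b - c by exists (b - c).
have ww : adj w = w by rewrite wE adjB bb cc.
have wK : `|w| <= K.
  rewrite wE (le_trans (ler_normB _ _))// /K addrAC lerD2r.
  rewrite -(ler_pXn2r (n := 2)) ?nnegrE ?addr_ge0// -norm_sqr// bsq.
  rewrite (le_trans (ler_normD _ _))// norm_sqr// normA gtr0_norm//.
  have := normr_ge0 c; nra.
have wb : GRing.comm w b by rewrite wE; apply/commr_sym/commrB => //; exact: commr_sym.
have wc : GRing.comm w c by rewrite wE; apply/commr_sym/commrB.
have wbc : w * (b + c) = d%:A.
  by rewrite wE mulrDr !mulrBl cb subrKA bsq addrC addKr.
have E : w * c * w = d *: w - w * b * w.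
  rewrite -[X in w * X * w](addKr b) mulrDr mulrDl wbc -scalerAl mul1r.
  by rewrite mulrN mulNr addrC.
have pw : pos (w * b * w) by apply: pos_conj.
have Ey : adj (x * w) * (x * w) = w * c * w by rewrite adjM ww !mulrA.
have ns : `|w * c * w| <= d * K.
  rewrite -Ey; apply: norm_le_of_pos_sub.
    by rewrite mulr_ge0// ltW.
  rewrite Ey E opprB addrCA; apply: posD => //.
  by rewrite -scalerA -scalerBr; apply: posZ; [exact: ltW|exact: normr_pos_sub].
have nw : `|w| <= e.
  have w3 : `|w * w * w| <= e ^+ 3.
    have -> : w * w * w = d *: w - (w * c * w) *+ 2.
      rewrite {2}wE mulrBr mulrBl mulr2n opprD addrA; congr (_ - _).
      by rewrite E opprB addrCA subrr addr0.
    apply: le_trans dK; rewrite (le_trans (ler_normB _ _))// normrMn.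
    rewrite normZ gtr0_norm// (_ : 3 * d * K = d * K + (d * K) *+ 2); last by ring.
    by rewrite lerD ?lerMn2r//= ler_pM2l.
  have [->|w0] := eqVneq w 0; first by rewrite normr0 ltW.
  have w_gt0 : 0 < `|w| by rewrite normr_gt0.
  rewrite -(ler_pXn2r (n := 3)) ?nnegrE//; last exact: ltW.
  apply: (le_trans _ w3).
  (* [norm_exp2] covers powers of two, so the cube is reached through |w|^4 = |w^4| <= |w^3| |w|. *)
  rewrite -(ler_pM2r w_gt0) -exprSr -(norm_exp2 2 ww).
  by rewrite (_ : w ^+ (2 ^ 2) = w * w * w * w) ?normM// !exprS expr0 mulr1 !mulrA.
have -> : c + e%:A = b + (e%:A - w) by rewrite wE opprB addrCA subrKC addrC.
by apply: posD => //; exact: normr_pos_sub.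
Qed.

End Kaplansky.

(** * The Hahn-Banach theorem for sublinear functionals *)

Section HahnBanach.
Variables (R : realType) (V : lmodType R).
Implicit Types (p q : V -> R) (x y : V) (t : R).

Definition sublinear p :=
  (forall x y, p (x + y) <= p x + p y) /\
  (forall t x, 0 <= t -> p (t *: x) <= t * p x).

Lemma sublinear0 p : sublinear p -> p 0 = 0.
Proof.
move=> [pD pZ]; apply/le_anti/andP; split.
  by have := pZ 0 0 (lexx _); rewrite scale0r mul0r.
by have := pD 0 0; rewrite addr0 lerDl.
Qed.

Lemma sublinear_ge p x : sublinear p -> - p (- x) <= p x.
Proof.
move=> sp; rewrite lerNl -subr_ge0 opprK -(sublinear0 sp) -(addNr x).
by case: sp => pD _; exact: pD.
Qed.

Lemma sublinearZ p t x : sublinear p -> 0 <= t -> p (t *: x) = t * p x.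
Proof.
move=> sp; have [_ pZ] := sp; rewrite le_eqVlt => /predU1P[<-|t0].
  by rewrite scale0r mul0r sublinear0.
apply/le_anti; rewrite (pZ _ _ (ltW t0))/= -ler_pdivlMl//.
have := pZ t^-1 (t *: x); rewrite scalerA mulVf ?gt_eqF// scale1r.
by apply; rewrite invr_ge0 ltW.
Qed.

Lemma inf_le (S : set R) r z : (forall s, S s -> r <= s) -> S z -> inf S <= z.
Proof. by move=> lb Sz; apply: ge_inf => //; exists r. Qed.

(** q x is the infimum of p (x + t y) - t p y over t >= 0; t = 0 gives q <= p, and t = 1 at - y
    gives the last bound. *)
Lemma sublinear_shift p y : sublinear p ->
  exists q, [/\ sublinear q, forall x, q x <= p x & q (- y) <= - p y].
Proof.
move=> sp; have [pD pZ] := sp.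
pose S x := [set p (x + t *: y) - t * p y | t in [set t | 0 <= t]]%classic.
have Sne x : (S x !=set0)%classic.
  by exists (p (x + 0 *: y) - 0 * p y), 0 => /=.
have Slb x s : S x s -> - p (- x) <= s.
  move=> [t /= t0 <-]; rewrite -sublinearZ//.
  by have := pD (x + t *: y) (- x); rewrite addrAC subrr add0r; lra.
pose q x := inf (S x).
have qle x t : 0 <= t -> q x <= p (x + t *: y) - t * p y.
  by move=> t0; apply: (inf_le (Slb x)); exists t.
have leq_q x r : (forall t, 0 <= t -> r <= p (x + t *: y) - t * p y) -> r <= q x.
  by move=> H; apply: lb_le_inf => // s [t t0 <-]; exact: H.
exists q; split; last 2 first.
- by move=> x; have := qle x 0 (lexx _); rewrite scale0r mul0r addr0 subr0.
- by have := qle (- y) 1 ler01; rewrite scale1r mul1r addNr (sublinear0 sp) sub0r.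
split=> [x x'|t x].
  rewrite -lerBlDl; apply: (leq_q) => t t0; rewrite lerBlDl -lerBlDr.
  apply: (leq_q) => s s0; rewrite lerBlDr.
  apply: le_trans (qle _ (s + t) (addr_ge0 s0 t0)) _.
  have := pD (x + s *: y) (x' + t *: y); rewrite addrACA -scalerDl; lra.
rewrite le_eqVlt => /predU1P[<-|t0].
  have := qle 0 0 (lexx _); rewrite !scale0r !mul0r addr0 subr0.
  by rewrite (sublinear0 sp).
rewrite -ler_pdivrMl//; apply: (leq_q) => s s0; rewrite ler_pdivrMl//.
apply: le_trans (qle _ (t * s) (mulr_ge0 (ltW t0) s0)) _.
have := pZ t (x + s *: y) (ltW t0); rewrite scalerDr scalerA; lra.
Qed.

(** Zorn's lemma for the reversed pointwise order. A nonempty chain is bounded by its pointwise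
    infimum, finite because sublinear minorants of p are at least - p (- x) at x. *)
Lemma sublinear_minimal p : sublinear p -> exists q, [/\ sublinear q,
  forall x, q x <= p x &
  forall r, sublinear r -> (forall x, r x <= q x) -> forall x, q x <= r x].
Proof.
move=> sp; pose T := {q | sublinear q /\ forall x, q x <= p x}.
pose le (q1 q2 : T) := `[< forall x, sval q2 x <= sval q1 x >].
have [|||q qmax] := @ZL_preorder T (exist _ p (conj sp (fun=> lexx _))) le.
- by move=> q; apply/asboolP.
- move=> q1 q2 q3 /asboolP le12 /asboolP le23; apply/asboolP => x.
  exact: le_trans (le12 x).
- move=> C Ctot; have [[c0 Cc0]|C0] := pselect (exists c, C c); last first.
    by exists (exist _ p (conj sp (fun=> lexx _))) => s Cs; case: C0; exists s.
  pose S x := [set sval c x | c in C]%classic.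
  have Slb x s : S x s -> - p (- x) <= s.
    move=> [[c [sc cp]] Cc /= <-]; rewrite (le_trans _ (sublinear_ge x sc))//.
    by rewrite lerN2.
  pose q x := inf (S x).
  have qle c x : C c -> q x <= sval c x.
    by move=> Cc; apply: (inf_le (Slb x)); exists c.
  have leq_q x r : (forall c, C c -> r <= sval c x) -> r <= q x.
    move=> H; apply: lb_le_inf; first by exists (sval c0 x); exists c0.
    by move=> s [c Cc <-]; exact: H.
  have sq : sublinear q.
    split=> [x y|t x].
      rewrite -lerBlDl; apply: (leq_q) => c Cc; rewrite lerBlDl -lerBlDr.
      apply: (leq_q) => d Cd; rewrite lerBlDr.
      (* Of the two members of the chain, the smaller serves for both x and y. *)
      have [/asboolP cd|/asboolP dc] := Ctot _ _ Cc Cd.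
        apply: le_trans (qle _ _ Cd) _; case: (svalP d) => -[dD _] _.
        by rewrite (le_trans (dD _ _))// lerD2l.
      apply: le_trans (qle _ _ Cc) _; case: (svalP c) => -[cD _] _.
      by rewrite (le_trans (cD _ _))// lerD2r.
    rewrite le_eqVlt => /predU1P[<-|t0].
      rewrite scale0r mul0r; apply: le_trans (qle _ _ Cc0) _.
      by case: (svalP c0) => sc _; rewrite sublinear0.
    rewrite -ler_pdivrMl//; apply: (leq_q) => c Cc; rewrite ler_pdivrMl//.
    apply: le_trans (qle _ _ Cc) _; case: (svalP c) => -[_ cZ] _.
    exact/cZ/ltW.
  have qp x : q x <= p x.
    by apply: le_trans (qle _ _ Cc0) _; case: (svalP c0).
  by exists (exist _ q (conj sq qp)) => s Cs; apply/asboolP => x; exact: qle.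
case: q qmax => q [sq qp] qmax; exists q; split=> // r sr rq x.
have rp z : r z <= p z by apply: le_trans (qp z).
have /asboolP := qmax (exist _ r (conj sr rp)) (asboolT rq); exact.
Qed.

(* A minimal sublinear functional q is odd, since its shift along y is not
   smaller than q; hence it is linear. *)
Theorem hahn_banach_sublinear p y : sublinear p ->
  exists f : {scalar V}, (forall x, f x <= p x) /\ f y = p y.
Proof.
(* Shifting along y first ensures f (- y) <= - p y, the half of f y = p y that f <= p does not
   give. *)
move=> sp; have [p' [sp' p'p p'y]] := sublinear_shift y sp.
have [q [sq qp' qmin]] := sublinear_minimal sp'; have [qD _] := sq.
have qN x : q (- x) = - q x.
  apply/le_anti/andP; split; last by have := sublinear_ge (- x) sq; rewrite opprK.
  have [r [sr rq ry]] := sublinear_shift x sq.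
  exact: le_trans (qmin _ sr rq _) ry.
have qD' x z : q (x + z) = q x + q z.
  apply/le_anti; rewrite qD/= -[_ + z]opprK qN lerNr !opprD -!qN; exact: qD.
have qZ' t x : q (t *: x) = t * q x.
  have [|/ltW t0] := leP 0 t; first exact: sublinearZ.
  by rewrite -[t]opprK scaleNr qN sublinearZ ?oppr_ge0// !mulNr.
have qlin : scalar q by move=> t x z; rewrite qD' qZ'.
pose F : {scalar V} := HB.pack q (GRing.isLinear.Build R V R _ q qlin).
exists F; split=> [x|]; first exact: le_trans (qp' x) (p'p x).
change (q y = p y); apply/le_anti; rewrite (le_trans (qp' y) (p'p y))/=.
by rewrite -[q y]opprK lerNr -qN (le_trans (qp' _)).
Qed.

End HahnBanach.

(** * States *)

Section UpperRange.
Variables (R : realType) (A : cstarAlgType R).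
Local Notation B := (realAlg A).
Implicit Types (x y h b c : B) (s t : R).
Implicit Types f : {linear A -> R[i]^o}.

(* As t grows, `|t + x| - t decreases to the maximum of [Re f x] over the states f. *)
Definition upper_range (x : B) : R := inf [set `|t%:A + x| - t | t in [set: R]]%classic.

Lemma upper_range_le x t : upper_range x <= `|t%:A + x| - t.
Proof.
apply: ge_inf; last by exists t.
exists (- `|x|) => _ [s _ <-].
have := ler_normB (s%:A + x) x; rewrite addrK normA.
by have := ler_norm s; lra.
Qed.

Lemma le_upper_range x r : (forall t, r <= `|t%:A + x| - t) -> r <= upper_range x.
Proof.
move=> H; apply: lb_le_inf; first by exists (`|0%:A + x| - 0); exists 0.
by move=> s [t _ <-]; exact: H.
Qed.

Lemma upper_range_norm x : upper_range x <= `|x|.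
Proof. by have := upper_range_le x 0; rewrite scale0r add0r subr0. Qed.

Lemma upper_range_sublinear : sublinear upper_range.
Proof.
split=> [x y|t x].
  rewrite -lerBlDl; apply: le_upper_range => t; rewrite lerBlDl -lerBlDr.
  apply: le_upper_range => s; rewrite lerBlDr.
  apply: le_trans (upper_range_le _ (s + t)) _.
  have := ler_normD (s%:A + x) (t%:A + y); rewrite addrACA -scalerDl; lra.
rewrite le_eqVlt => /predU1P[<-|t0].
  by rewrite scale0r mul0r (le_trans (upper_range_norm _))// normr0.
rewrite -ler_pdivrMl//; apply: le_upper_range => s; rewrite ler_pdivrMl//.
apply: le_trans (upper_range_le _ (t * s)) _.
by rewrite -scalerA -scalerDr normZ gtr0_norm// mulrBr.
Qed.

(** For a value r = |t + h| - t below s, the element r - h = |t + h| - (t + h) has witness |t +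
    h|. *)
Lemma upper_range_lt h s : adj h = h -> upper_range h < s ->
  exists2 r, r < s & pos (r%:A - h).
Proof.
move=> hh hs; have [|_ [t _ <-] ts] := inf_lt _ hs.
  by exists (`|0%:A + h| - 0), 0.
exists (`|t%:A + h| - t) => //; split; first by rewrite adjB adjA hh.
by exists `|t%:A + h|; rewrite scalerBl opprB addrCA subKr addrC.
Qed.

(** Otherwise r - h is positive for some r < |h|; then r >= 0, so r + h is positive too and
    [pos_norm] gives |h| <= r. *)
Lemma upper_range_pos h : pos h -> upper_range h = `|h|.
Proof.
move=> ph; have [hh _] := ph; apply/le_anti; rewrite upper_range_norm/= leNgt.
apply/negP => /(upper_range_lt hh)[r rh pr].
have r0 : 0 <= r by have := posD ph pr; rewrite subrKC => /posA_ge0.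
have := pos_norm pr (posD (posA _ r0) ph); lra.
Qed.

(** Were both values below |h|, some r, s < |h| would make r + h and s - h positive, and [pos_norm]
    would give |h| <= max(r, s). *)
Lemma upper_range_adj h : adj h = h ->
  upper_range h = `|h| \/ upper_range (- h) = `|h|.
Proof.
move=> hh; have [->|h1] := eqVneq (upper_range h) `|h|; [by left|right].
apply/le_anti; rewrite -{1}normrN upper_range_norm/= leNgt; apply/negP.
have hN : adj (- h) = - h by rewrite adjN hh.
move=> /(upper_range_lt hN)[r rh pr]; rewrite opprK in pr.
have {h1}/(upper_range_lt hh)[s sh ps] : upper_range h < `|h|.
  by rewrite lt_neqAle h1 upper_range_norm.
have : `|h| <= Num.max r s.
  apply: pos_norm.
    rewrite -(subrK s (Num.max r s)) scalerDl -addrA; apply: posD => //.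
    by apply: posA; rewrite subr_ge0 le_max lexx orbT.
  rewrite -(subrK r (Num.max r s)) scalerDl -addrA; apply: posD => //.
  by apply: posA; rewrite subr_ge0 le_max lexx.
by rewrite leNgt gt_max rh sh.
Qed.

Lemma rnorm_sqr (z : R[i]^o) : rnorm z ^+ 2 = complex.Re z ^+ 2 + complex.Im z ^+ 2.
Proof. by rewrite /rnorm normc_def/= sqr_sqrtr// addr_ge0// sqr_ge0. Qed.

(** The complex functional with real part F is f x = F x - i F (i x). Since F 1 = 1 and |f 1| <= 1,
    the imaginary part of f 1 vanishes. *)
Lemma state_of_functional (F : {scalar B}) :
  (forall x, F x <= `|x|) -> F 1 = 1 ->
  exists f, is_state f /\ forall x, complex.Re (f x) = F x.
Proof.
move=> Fle F1; pose FA (x : A) : R := F x.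
have FD x y : FA (x + y) = FA x + FA y by exact: (linearD F).
have FR t (x : A) : FA ((t%:C)%C *: x) = t * FA x by exact: (scalarZ F t x).
have FZ (k : R[i]) (x : A) :
    FA (k *: x) = complex.Re k * FA x + complex.Im k * FA ('i%C *: x).
  by rewrite {1}(complexE k) scalerDl mulrC -scalerA FD !FR.
pose g (x : A) : R[i]^o := (FA x +i* - FA ('i%C *: x))%C.
have glin : GRing.linear_for *:%R g.
  move=> k x y; rewrite /g scalerDr (scalerA 'i%C) !FD (FZ k) (FZ (_ * k)).
  case: k => a b; apply/eqP; rewrite eq_complex/=; apply/andP; split; apply/eqP; ring.
have [f fE] : exists f : {linear A -> R[i]^o}, forall x, f x = g x.
  pose f : {linear A -> R[i]^o} :=
    HB.pack g (GRing.isLinear.Build R[i] A R[i]^o _ g glin).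
  by exists f.
have Ref x : complex.Re (f x) = F x by rewrite fE.
have fle x : rnorm (f x) <= rnorm (x : A).
  have [->|fx0] := eqVneq (rnorm (f x)) 0; first exact: rnorm_ge0.
  have n0 : 0 < rnorm (f x) by rewrite lt_neqAle eq_sym fx0 rnorm_ge0.
  (* A unimodular k with k f(x) = |f(x)|, so that |f(x)| = F (k x) <= |x|. *)
  pose k : R[i] :=
    (complex.Re (f x) / rnorm (f x) +i* - (complex.Im (f x) / rnorm (f x)))%C.
  have k1 : complex.Re `|k| = 1.
    rewrite normc_def/= sqrrN !expr_div_n -mulrDl -rnorm_sqr divff ?sqrtr1//.
    by rewrite expf_neq0.
  have <- : complex.Re (f (k *: (x : A))) = rnorm (f x).
    have -> : f (k *: (x : A)) = k * f x by rewrite linearZ.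
    apply: (mulfI fx0); rewrite -expr2 rnorm_sqr.
    rewrite /k; case: (f x) fx0 {k k1 n0} => a b /= fx0; field.
    exact: fx0.
  rewrite Ref (le_trans (Fle _))//.
  by rewrite -[`|_|]/(rnorm (k *: (x : A))) rnormZ k1 mul1r.
have f1 : f cone = 1.
  have Re1 : complex.Re (f cone) = 1 by rewrite Ref.
  apply/eqP; rewrite eq_complex Re1 eqxx/= -sqrf_eq0 eq_le sqr_ge0 andbT.
  have := fle (cone : A); rewrite -(ler_pXn2r (n := 2)) ?nnegrE ?rnorm_ge0//.
  rewrite rnorm_sqr Re1 [rnorm _](norm1 A).
  by rewrite expr1n gerDl.
exists f; split=> //; split=> //.
- apply/linear_bounded_continuous/bounded_funP => r; exists r => x.
  by apply: le_trans; rewrite !rnormC lecR fle.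
- apply/le_anti/andP; split.
    apply: ge_sup; first by exists (rnorm (f 0)), 0; rewrite //= /rnorm normr0.
    by move=> _ [x /= x1 <-]; exact: le_trans x1.
  apply: ub_le_sup; first by exists 1 => _ [x /= x1 <-]; exact: le_trans x1.
  exists cone; first by rewrite /= [rnorm _](norm1 A).
  by rewrite f1 /rnorm normr1.
Qed.

End UpperRange.

Section States.
Variables (R : realType) (A : cstarAlgType R).
Local Notation B := (realAlg A).
Implicit Types (x y h b c : B) (s t : R).
Implicit Types f : {linear A -> R[i]^o}.

Lemma exists_state_upper_range y :
  exists f, is_state f /\ complex.Re (f y) = upper_range y.
Proof.
have [F [Fu Fy]] := hahn_banach_sublinear y (upper_range_sublinear A).
have [||f [fs fF]] := @state_of_functional R A F.
- by move=> x; exact: le_trans (upper_range_norm x).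
- apply/le_anti/andP; split.
    by rewrite (le_trans (Fu _))// (le_trans (upper_range_norm _))// norm1.
  (* [upper_range] at -1 is at most |1 - 1| - 1 = -1, hence F 1 >= 1. *)
  have := le_trans (Fu (-1)) (upper_range_le (-1) 1).
  by rewrite scale1r subrr normr0 linearN sub0r lerN2.
by exists f; rewrite fF Fy.
Qed.

Lemma exists_state_adj h : adj h = h ->
  exists f, is_state f /\ complex.Re (f h) ^+ 2 = `|h| ^+ 2.
Proof.
move=> hh; have [<-|<-] := upper_range_adj hh.
  by have [f [fs <-]] := exists_state_upper_range h; exists f.
have [f [fs <-]] := exists_state_upper_range (- h); exists f.
by rewrite (linearN f) raddfN sqrrN.
Qed.

Lemma exists_state_pos h : pos h -> exists f, is_state f /\ complex.Re (f h) = `|h|.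
Proof. by move=> /upper_range_pos <-; exact: exists_state_upper_range. Qed.

Section State.
Variable f : {linear A -> R[i]^o}.
Hypothesis fs : is_state f.

Lemma state_le (x : A) : rnorm (f x) <= rnorm x.
Proof.
have [fc _ fn] := fs.
(* The supremum [functional_norm] bounds its set only when that set is bounded; continuity of f
   supplies this. *)
have [r r0 rP] : exists2 r, 0 < r & forall x : A, rnorm (f x) <= r * rnorm x.
  have /linear_bounded_continuous/linear_boundedP/pinfty_ex_gt0[r r0 rP] := fc.
  move: r0 rP; case: r => r r'; rewrite ltcE/= => /andP[/eqP -> r0] rP.
  by exists r => // y; have := rP y; rewrite complexr0 !rnormC
    -(rmorphM (real_complex R)) lecR.
have [x0|x0] := eqVneq (rnorm x) 0.
  by rewrite x0 (le_trans (rP x))// x0 mulr0.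
have n0 : 0 < rnorm x by rewrite lt_neqAle eq_sym x0 rnorm_ge0.
pose y : A := ((rnorm x)^-1%:C)%C *: x.
have y1 : rnorm y = 1.
  by rewrite -[rnorm y]/(`|(rnorm x)^-1 *: (x : B)|) normZ gtr0_norm ?invr_gt0// mulVf.
have fy : rnorm (f y) <= 1.
  rewrite -fn; apply: ub_le_sup; last by exists y => //=; rewrite y1.
  exists r => _ [z /= z1 <-]; rewrite (le_trans (rP z))//.
  by rewrite -[leRHS]mulr1 ler_wpM2l// ltW.
move: fy; have -> : f y = ((rnorm x)^-1%:C)%C *: f x by rewrite linearZ.
rewrite rnormZ normc_def/= expr0n addr0 sqrtr_sqr gtr0_norm ?invr_gt0//.
by rewrite ler_pdivrMl// mulr1.
Qed.

(* |f(h + i t)|^2 <= ||h||^2 + t^2 for all real t is impossible if f(h) is not real. *)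
Lemma state_adj (h : B) : adj h = h -> complex.Im (f h) = 0.
Proof.
move=> hh; have [_ f1 _] := fs.
apply/eqP/negPn/negP => I0.
(* Chosen so that 2 t Im f(h) = |h|^2 + 1, whence |f(h + i t)|^2 >= |h|^2 + 1 + t^2. *)
pose t := (`|h| ^+ 2 + 1) / (2 * complex.Im (f h)).
pose u : B := h + imag A * t%:A.
have fu : f u = f h + (0 +i* t)%C.
  have -> : (u : A) = (h : A) + (0 +i* t)%C *: (cone : A).
    have -> : (0 +i* t)%C = (t%:C)%C * 'i%C :> R[i] by simpc.
    by rewrite /u -scalerAr mulr1 -scalerA.
  rewrite linearD linearZ f1; congr (_ + _); exact: mulr1.
have un : rnorm u ^+ 2 <= `|h| ^+ 2 + t ^+ 2.
  rewrite -[rnorm u]/(`|u|) -(cstar u) /u adj_mul_cartesian ?adjA//; last exact: commA.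
  rewrite (le_trans (ler_normD _ _))// norm_sqr// -scalerAl mul1r scalerA.
  by rewrite -expr2 normA ger0_norm ?sqr_ge0.
have := state_le u; rewrite -(ler_pXn2r (n := 2)) ?nnegrE ?rnorm_ge0//.
move=> /le_trans/(_ un); rewrite rnorm_sqr fu.
have -> : complex.Re (f h + (0 +i* t)%C) = complex.Re (f h).
  by case: (f h) => a b /=; ring.
have -> : complex.Im (f h + (0 +i* t)%C) = complex.Im (f h) + t.
  by case: (f h) => a b /=; ring.
have := sqr_ge0 (complex.Re (f h)); have := sqr_ge0 (complex.Im (f h)).
have : 2 * complex.Im (f h) * t = `|h| ^+ 2 + 1.
  by rewrite /t mulrC divfK// mulf_neq0.
lra.
Qed.

(** f(h) is real and |t - f(h)| = |f(t - h)| <= t. *)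
Lemma state_pos (h : B) : pos h -> 0 <= f h.
Proof.
move=> [hh [t ht]]; have [_ f1 _] := fs.
rewrite lecE (state_adj hh) eqxx/=.
have t0 : 0 <= t := le_trans (normr_ge0 _) ht.
have := state_le (t%:A - h : B).
have -> : f (t%:A - h : B) = (t%:C)%C - f h.
  rewrite -[t%:A - h]/((t%:C)%C *: (cone : A) - (h : A)) linearB linearZ f1.
  congr (_ - _); exact: mulr1.
move=> /le_trans/(_ ht); rewrite -(ler_pXn2r (n := 2)) ?nnegrE ?rnorm_ge0//.
rewrite rnorm_sqr; case: (f h) => a b /= ab; rewrite leNgt; apply/negP => a0.
have := sqr_ge0 (0 - b); have : 0 < a * a by rewrite nmulr_rgt0.
have : 0 <= t * - a by rewrite mulr_ge0// oppr_ge0 ltW.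
move: ab; rewrite !expr2; lra.
Qed.

End State.
End States.

(** * The numerical radius *)

Section NumericalRadius.
Variables (R : realType) (A : cstarAlgType R).
Local Notation B := (realAlg A).
Implicit Types (x : B) (f : {linear A -> R[i]^o}).

Lemma Re_le_rnorm (z : R[i]^o) : complex.Re z <= rnorm z.
Proof.
by apply: (le_trans (ler_norm _)); rewrite -lecR -rnormC; exact: normc_ge_Re.
Qed.

Lemma ReZ (t : R) (z : R[i]) : complex.Re ((t%:C)%C * z) = t * complex.Re z.
Proof. by case: z => u v /=; rewrite mul0r subr0. Qed.

Lemma numerical_radius_ge x f : is_state f -> rnorm (f x) <= numerical_radius x.
Proof.
move=> fs; apply: ub_le_sup; last by exists f.
by exists (rnorm (x : A)) => _ [g gs <-]; exact: state_le.
Qed.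

Lemma state_cartesian x f : is_state f ->
  rnorm (f x) ^+ 2 = complex.Re (f (rePart x)) ^+ 2 + complex.Re (f (imPart x)) ^+ 2.
Proof.
move=> fs; rewrite rnorm_sqr.
have -> : f x = f (rePart x) + 'i%C * f (imPart x).
  rewrite [in LHS](cartesianE x).
  have -> : imag A * imPart x = 'i%C *: (imPart x : A).
    by rewrite -[LHS]/(('i%C *: (cone : A)) ** (imPart x : A)) -cscaleAl cmul1l.
  rewrite -[_ + _]/((rePart x : A) + 'i%C *: (imPart x : A)) linearD; congr (_ + _).
  exact: linearZ.
have := state_adj fs (rePart_adj x); have := state_adj fs (imPart_adj x).
case: (f _) => a b; case: (f _) => c d /= -> ->; ring.
Qed.

Lemma radius_sqr_ge x f : is_state f ->
  complex.Re (f (rePart x)) ^+ 2 + complex.Re (f (imPart x)) ^+ 2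
    <= numerical_radius x ^+ 2.
Proof.
move=> fs; rewrite -state_cartesian//.
have fv := numerical_radius_ge x fs.
by rewrite lerXn2r// nnegrE ?(le_trans _ fv)// rnorm_ge0.
Qed.

Lemma norm_rePart_le x : `|rePart x : B| ^+ 2 <= numerical_radius x ^+ 2.
Proof.
have [f [fs <-]] := exists_state_adj (rePart_adj x).
by rewrite (le_trans _ (radius_sqr_ge x fs))// lerDl sqr_ge0.
Qed.

Lemma norm_imPart_le x : `|imPart x : B| ^+ 2 <= numerical_radius x ^+ 2.
Proof.
have [f [fs <-]] := exists_state_adj (imPart_adj x).
by rewrite (le_trans _ (radius_sqr_ge x fs))// lerDr sqr_ge0.
Qed.

Lemma norm_add_parts_le x :
  `|(rePart x : B) + imPart x| ^+ 2 <= 2 * numerical_radius x ^+ 2.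
Proof.
have [|f [fs <-]] := @exists_state_adj _ _ ((rePart x : B) + imPart x).
  by rewrite adjD rePart_adj imPart_adj.
have := radius_sqr_ge x fs; rewrite (linearD f) raddfD.
set u := complex.Re _; set v := complex.Re (f (imPart x)).
have := sqr_ge0 (u - v); rewrite !expr2; lra.
Qed.

Lemma norm_sub_parts_le x :
  `|(rePart x : B) - imPart x| ^+ 2 <= 2 * numerical_radius x ^+ 2.
Proof.
have [|f [fs <-]] := @exists_state_adj _ _ ((rePart x : B) - imPart x).
  by rewrite adjB rePart_adj imPart_adj.
have := radius_sqr_ge x fs; rewrite (linearB f) raddfB.
set u := complex.Re _; set v := complex.Re (f (imPart x)).
have := sqr_ge0 (u + v); rewrite !expr2; lra.
Qed.

Lemma norm_adj_self_add_le x :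
  `|adj x * x + x * adj x| <= 2 * (`|rePart x : B| ^+ 2 + `|imPart x : B| ^+ 2).
Proof.
rewrite adj_self_add normZ ger0_norm// ler_pM2l// (le_trans (ler_normD _ _))//.
by rewrite !norm_sqr ?rePart_adj ?imPart_adj.
Qed.

Lemma norm_adj_self_add_le' x :
  `|adj x * x + x * adj x| <=
  `|(rePart x : B) + imPart x| ^+ 2 + `|(rePart x : B) - imPart x| ^+ 2.
Proof.
rewrite -!norm_sqr ?adjB ?adjD ?rePart_adj ?imPart_adj//.
rewrite (le_trans _ (ler_normD _ _))// adj_self_add.
move: (rePart x : B) (imPart x : B) => p q.
rewrite (_ : (p + q) * (p + q) + _ = 2 *: (p * p + q * q))//.
rewrite mulrBl !mulrBr mulrDl !mulrDr opprB [q * p + _]addrC addrACA.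
rewrite [p * p + _ + _]addrACA [q * q + _ + _]addrACA !subrr !addr0.
by rewrite (scaler_nat 2) mulr2n addrACA.
Qed.

Lemma norm_adj_self_add_ge x (alpha beta : R) :
  1 <= beta -> alpha_beta_normal alpha beta x ->
  Num.max (1 + alpha ^+ 2) (1 + 1 / beta ^+ 2) * `|x| ^+ 2 <=
  `|adj x * x + x * adj x|.
Proof.
move=> b1 xn.
have state_bound f : is_state f ->
    [/\ complex.Re (f (adj x * x)) + complex.Re (f (x * adj x)) <=
          `|adj x * x + x * adj x|,
      alpha ^+ 2 * complex.Re (f (adj x * x)) <= complex.Re (f (x * adj x)) &
      complex.Re (f (x * adj x)) <= beta ^+ 2 * complex.Re (f (adj x * x))].
  move=> fs; have [fc _ _] := fs.
  have fpos : is_positive f by move=> y; have := state_pos fs (adj_mul_self_pos y).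
  have [lo hi] := xn f fc fpos; split.
  - apply: le_trans (state_le fs (adj x * x + x * adj x)).
    rewrite -raddfD/= -(linearD f); exact: Re_le_rnorm.
  - by move: lo; rewrite lecE => /andP[_]; rewrite ReZ.
  - by move: hi; rewrite lecE => /andP[_]; rewrite ReZ.
have [f [fs fE]] := exists_state_pos (adj_mul_self_pos x).
have [g [gs gE]] := exists_state_pos (adj_mul_self_pos (adj x)).
rewrite cstar in fE; rewrite cstar adjK norm_adj in gE.
have [f1 f2 _] := state_bound f fs; have [g1 _ g3] := state_bound g gs.
have b0 : 0 < beta ^+ 2 by rewrite exprn_gt0// (lt_le_trans ltr01).
rewrite maxr_pMl ?sqr_ge0// ge_max; apply/andP; split.
  by rewrite fE in f1 f2; lra.
rewrite gE in g1 g3; rewrite -ler_pdivrMl// in g3.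
by apply: le_trans g1; rewrite mulrDl !mul1r addrC lerD2r.
Qed.

End NumericalRadius.

Theorem corollary2p13 (R : realType) (A : cstarAlgType R) (alpha beta : R)
    (a : A) (alpha_ge0 : 0 <= alpha) (alpha_le1 : alpha <= 1)
    (beta_ge1 : 1 <= beta) (a_normal : alpha_beta_normal alpha beta a) :
  let lower := 4^-1 * Num.max (1 + alpha ^+ 2) (1 + 1 / beta ^+ 2)
               * rnorm a ^+ 2 in
  let l := `|rnorm (rePart a) ^+ 2
             - 4^-1 * rnorm (star a ** a + a ** star a)| in
  let m := `|rnorm (imPart a) ^+ 2
             - 4^-1 * rnorm (star a ** a + a ** star a)| in
  [/\ numerical_radius a ^+ 2 >=
        lower + 2^-1 * `|rnorm (rePart a) ^+ 2 - rnorm (imPart a) ^+ 2|,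
      numerical_radius a ^+ 2 >=
        lower + 4^-1 * `|rnorm (rePart a + imPart a) ^+ 2
                         - rnorm (rePart a - imPart a) ^+ 2|
    & numerical_radius a ^+ 2 >= lower + 4^-1 * (l + m)].
Proof.
have := norm_adj_self_add_ge beta_ge1 a_normal.
have := norm_adj_self_add_le' a; have := norm_adj_self_add_le a.
have := norm_sub_parts_le a; have := norm_add_parts_le a.
have := norm_imPart_le a; have := norm_rePart_le a.
rewrite -![`|_|]/(rnorm (_ : A)).
set p := rnorm (rePart a) ^+ 2; set q := rnorm (imPart a) ^+ 2.
set u := rnorm (_ + _) ^+ 2; set v := rnorm (_ - _) ^+ 2.
set s := rnorm (_ + _); set v2 := numerical_radius a ^+ 2.
set mx := Num.max _ _; set n2 := rnorm a ^+ 2 => pv qv uv vv spq suv sl.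
have {}sl : 4^-1 * mx * n2 <= 4^-1 * s by rewrite -mulrA ler_pM2l// invr_gt0.
(* In turn: v2 >= max(p, q) = (p + q) / 2 + |p - q| / 2; v2 >= max(u, v) / 2 = (u + v) / 4 + |u - v|
   / 4; a split on signs, where s <= 2 (p + q) keeps p and q from both lying below s / 4. *)
split.
- by case: (ger0P (p - q)) => ?; lra.
- by case: (ger0P (u - v)) => ?; lra.
- by case: (ger0P (p - 4^-1 * s)) => ?; case: (ger0P (q - 4^-1 * s)) => ?; lra.
Qed.
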